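(* For each $m$, let $\mathcal{N}(m)$ denote the number of isomorphism classes of maximal Arrow's single-peaked domains on $m$ elements. Let $\mathcal{P}(m)$ denote the total number of all maximal Arrow's single-peaked domains on a set of size $m$, without reduction under isomorphism, which all share a common (fixed) extremal path. Let $\mathcal{SP}(m)$ denote the number of isomorphism classes of self-paired maximal Arrow's single-peaked domains on a set of size $m$. Then $\mathcal{P}(3)=\mathcal{N}(3)=\mathcal{SP}(3)=1$, and for all $m\geq 4$ the following hold: (1) $\mathcal{P}(m)=2^{m-3}\,\mathcal{P}(m-1)$; (2) $\mathcal{N}(m)=\frac{1}{2}\left(\mathcal{P}(m)+\mathcal{SP}(m)\right)$; (3) $\frac{1}{2}\mathcal{P}(m)\leq \mathcal{N}(m)\leq \mathcal{P}(m)$.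
   Context: A linear order on a finite set $A$ of size $m$ is identified with a directed Hamilton path through $A$, i.e. a sequence $(a_1,\dots,a_m)$ listing every element of $A$ exactly once (most preferred first). A set $D$ of linear orders on $A$ is a Condorcet domain if there are no three orders in $D$ and distinct $a_1,a_2,a_3\in A$ such that the three orders rank these elements as $a_1\succ a_2\succ a_3$, $a_2\succ a_3\succ a_1$, $a_3\succ a_1\succ a_2$ respectively. It is maximal if it is not properly contained in another Condorcet domain on $A$. An Arrow's single-peaked domain is a Condorcet domain $D$ such that every triple (3-element subset) $T\subseteq A$ has a ''never-bottom'' element, i.e. an element of $T$ which no order of $D$ ranks last among the elements of $T$. A maximal Arrow's single-peaked domain is an Arrow's single-peaked domain which is maximal as a Condorcet domain. A terminal element (or terminal vertex) of $D$ is an element which is last in some order of $D$; a maximal Arrow's single-peaked domain has exactly two terminal elements $s,f$. A path in $D$ is extremal if it starts at one terminal element and ends at the other; $D$ has exactly two extremal paths, $P=(s,a_1,\dots,a_{m-2},f)$ and $Q$, which runs from $f$ to $s$. A permutation $\theta$ of $A$ acts on a path by applying it to each entry. The inherited permutation of $D$ is the permutation $\theta_D$ of $A$ with $\theta_D(P)=Q$ (it swaps $s$ and $f$; exchanging the roles of $P$ and $Q$ replaces it by its inverse). $D$ is self-paired if $\theta_D$ maps $D$ to itself, i.e. $\{\theta_D(W): W\in D\}=D$. Two domains are isomorphic if some bijection of the underlying sets carries one onto the other. *)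

(* Defs.v *)
From HB Require Import structures.
From mathcomp Require Import all_boot all_order all_fingroup all_algebra.

Set Implicit Arguments.
Unset Strict Implicit.
Unset Printing Implicit Defensive.

(* Most preferred element first.  Duplicate-freeness together with length
   #|T| forces every element of T to occur exactly once. *)
Record lorder (T : finType) := LOrder {
  lorder_tuple :> #|T|.-tuple T;
  lorder_uniq : uniq lorder_tuple
}.

HB.instance Definition _ (T : finType) := [isSub for @lorder_tuple T].
HB.instance Definition _ (T : finType) := [Finite of lorder T by <:].

Definition prefers (T : finType) (w : lorder T) (a b : T) : bool :=
  index a w < index b w.

Definition starts_at (T : finType) (w : lorder T) (x : T) : bool :=
  ohead w == Some x.

Definition ends_at (T : finType) (w : lorder T) (x : T) : bool :=
  ohead (rev w) == Some x.

Lemma path_image_uniq (T : finType) (t : {perm T}) (w : lorder T) :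
  uniq (map_tuple t w).
Proof. by rewrite map_inj_uniq ?lorder_uniq //; exact: perm_inj. Qed.

Definition path_image (T : finType) (t : {perm T}) (w : lorder T) : lorder T :=
  LOrder (path_image_uniq t w).

Definition domain_image (T : finType) (t : {perm T}) (D : {set lorder T}) :
    {set lorder T} :=
  [set path_image t w | w in D].

Definition condorcet (T : finType) (D : {set lorder T}) : bool :=
  ~~ [exists u in D, exists v in D, exists w in D,
      exists a1 : T, exists a2 : T, exists a3 : T,
        [&& uniq [:: a1; a2; a3],
            prefers u a1 a2 && prefers u a2 a3,
            prefers v a2 a3 && prefers v a3 a1
          & prefers w a3 a1 && prefers w a1 a2]].

Definition ranks_last (T : finType) (w : lorder T) (S : {set T}) (x : T) :
    bool :=
  (x \in S) && [forall y in S, (y != x) ==> prefers w y x].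

Definition never_bottom (T : finType) (D : {set lorder T}) (S : {set T})
    (x : T) : bool :=
  (x \in S) && [forall w in D, ~~ ranks_last w S x].

Definition arrow_single_peaked (T : finType) (D : {set lorder T}) : bool :=
  condorcet D &&
  [forall S : {set T}, (#|S| == 3) ==> [exists x : T, never_bottom D S x]].

(* Maximality is among all Condorcet domains, not only among Arrow's
   single-peaked ones. *)
Definition max_arrow (T : finType) (D : {set lorder T}) : bool :=
  arrow_single_peaked D && maxset (@condorcet T) D.

Definition terminal (T : finType) (D : {set lorder T}) (x : T) : bool :=
  [exists w in D, ends_at w x].

Definition extremal_from_to (T : finType) (D : {set lorder T}) (s f : T)
    (w : lorder T) : bool :=
  [&& s != f, terminal D s, terminal D f, w \in D, starts_at w s & ends_at w f].

Definition extremal (T : finType) (D : {set lorder T}) (w : lorder T) : bool :=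
  [exists s : T, exists f : T, extremal_from_to D s f w].

(* A relation rather than a function: the ordering of the two extremal paths
   is not canonical, so the permutation is determined only up to inversion.
   Invariance of D does not depend on this choice. *)
Definition inherited_perm (T : finType) (D : {set lorder T}) (t : {perm T}) :
    bool :=
  [exists s : T, exists f : T, exists P : lorder T, exists Q : lorder T,
    [&& extremal_from_to D s f P, extremal_from_to D f s Q
      & path_image t P == Q]].

Definition self_paired (T : finType) (D : {set lorder T}) : bool :=
  [exists t : {perm T}, inherited_perm D t && (domain_image t D == D)].

Definition isomorphic (T : finType) : rel {set lorder T} :=
  fun D1 D2 => [exists t : {perm T}, domain_image t D1 == D2].

Definition num_N (T : finType) : nat :=
  #|equivalence_partition (@isomorphic T) [set D | max_arrow D]|.

Definition num_P (T : finType) (p : lorder T) : nat :=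
  #|[set D : {set lorder T} | max_arrow D && extremal D p]|.

Definition num_SP (T : finType) : nat :=
  #|equivalence_partition (@isomorphic T)
      [set D | max_arrow D && self_paired D]|.

(* Main.v *)
Require Import Defs.
From mathcomp Require Import all_boot all_order all_fingroup all_algebra.
From mathcomp Require Import zify lra.

Import Order.TTheory GRing.Theory Num.Theory.

Set Implicit Arguments.
Unset Strict Implicit.
Unset Printing Implicit Defensive.

(** Everything rests on one recursive description of the domains.  Let [f] be a
    terminal element of an Arrow's single-peaked domain [D].  The tails below
    [f] of the orders of [D] form a chain for the suffix relation: if two of
    them differed, at their last difference there would be elements [a] and [b]
    such that one order puts [a] below [f] and [b], the other puts [b] below
    [f] and [a], while an order ending with [f] puts [f] below both, and the
    triple [a, b, f] would have no never-bottom element.  Removing [f] from an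
    order with a longest tail gives an order [q], and every order of [D] is
    obtained by inserting [f] in an order of a domain [E] on the other elements
    in such a way that what lies below [f] is a common suffix with [q].
    Conversely, this [extension E q] is a maximal domain whenever [E] is one
    and [q] belongs to [E].  Hence the maximal Arrow's single-peaked domains
    with terminal element [f] are exactly the extensions
    ([max_arrow_extension], [extension_max_arrow]).

    Maximality of the extensions is obtained through the stronger property
    [saturated], which an induction can carry: the domain consists of all
    orders that satisfy its never-bottom conditions, and every triple takes all
    four of the rankings that its condition leaves.

    The description shows that the terminal elements of [extension E q] are [f]
    and the last element of [q], and that exactly one of its orders starts with
    [f], namely [f] followed by [q].  So a maximal domain on [m >= 2] elements
    has two terminal elements, one extremal path from each ([extremal_pair]),
    and [2 ^ (m - 1)] orders, half of them ending at each terminal element: the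
    orders of [extension E q] that end with [f] are those of [E] followed by
    [f].

    For the recurrence, fix an extremal path that goes from [s] to [f].  The maximal
    domains with this extremal path correspond to the pairs [(E, q)] where [E]
    has the path without [f] as an extremal path and [q], in [E], ends with
    [s].  On [m - 1] elements there are [2 ^ (m - 3)] choices for [q], whence
    [num_P = 2 ^ 'C(m - 2, 2)] ([num_P_eq]).

    For the number of classes, each isomorphism class meets the set [X] of maximal domains with
    the fixed extremal path [p].  An isomorphism between members of [X] carries
    to [p] one of the two extremal paths of its source, so the members of [X]
    isomorphic to [D] are [D] and its image by the permutation that carries the
    second extremal path to [p].  This defines an involution of [X] whose
    fixed points are the self-paired domains.  Counting orbits gives
    [2 * num_N = num_P + num_SP] ([class_count]), and the bounds follow since
    [num_SP <= num_N]. *)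

(** * Linear orders and positions *)
Section Orders.

Variable T : finType.
Implicit Types (u v w : lorder T) (D E : {set lorder T}) (x y z : T).

Lemma size_lorder w : size w = #|T|.
Proof. exact: size_tuple. Qed.

Lemma mem_lorder w x : x \in (w : seq T).
Proof.
have sub : {subset (w : seq T) <= enum T} by move=> y _; rewrite mem_enum.
have [] := uniq_min_size (lorder_uniq w) sub; first by rewrite size_lorder cardE.
by move=> _ ->; rewrite mem_enum.
Qed.

Lemma index_lorder w x : index x w < #|T|.
Proof. by have := mem_lorder w x; rewrite -index_mem size_lorder. Qed.

Lemma index_lorder_inj w : injective (index^~ w).
Proof.
move=> x y /= e.
by rewrite -(nth_index x (mem_lorder w x)) e nth_index // mem_lorder.
Qed.

Lemma lorder_inj u v : u = v :> seq T -> u = v.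
Proof. by move=> e; apply/val_inj/val_inj. Qed.

Lemma eq_lorder u v : (forall x, index x u = index x v) -> u = v.
Proof.
move=> e; apply: lorder_inj.
have [x0 _|T0] := pickP T; last first.
  have nil w : w = [::] :> seq T by apply: size0nil; rewrite size_lorder eq_card0.
  by rewrite !nil.
apply: (@eq_from_nth _ x0); first by rewrite !size_lorder.
move=> i lt_i.
have lt_i' : i < size v by rewrite size_lorder -(size_lorder u).
apply: (@index_lorder_inj v).
by rewrite -e !index_uniq ?lorder_uniq.
Qed.

Lemma lorder_exists (s : seq T) :
  uniq s -> size s = #|T| -> exists w, w = s :> seq T.
Proof. by move=> us /eqP ss; exists (@LOrder T (Tuple ss) us). Qed.

Lemma lorder_inhabited : exists w, w \in [set: lorder T].
Proof.
have [w _] := lorder_exists (enum_uniq T) (esym (cardE T)).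
by exists w; rewrite inE.
Qed.

Lemma starts_atE w x : starts_at w x = (index x w == 0).
Proof.
rewrite /starts_at; have := mem_lorder w x; case: (w : seq T) => //= y s _.
by rewrite (inj_eq Some_inj); case: eqP.
Qed.

Lemma ends_atE w x : ends_at w x = (index x w == #|T|.-1).
Proof.
rewrite /ends_at; move: (mem_lorder w x) (lorder_uniq w) (size_lorder w).
move: (w : seq T) => s; case/lastP: s => // s y + + <-.
rewrite rcons_uniq rev_rcons size_rcons mem_rcons inE => /= xsy /andP [ys _].
rewrite (inj_eq Some_inj) -cats1 index_cat /= eq_sym.
move: xsy; have [->|neq /= xs] := eqVneq x y; first by rewrite (negPf ys) addn0 eqxx.
by rewrite xs ltn_eqF // index_mem.
Qed.

Lemma prefersN w x y : x != y -> ~~ prefers w x y = prefers w y x.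
Proof.
move=> neq; rewrite /prefers -leqNgt leq_eqVlt.
by rewrite (inj_eq (@index_lorder_inj w)) eq_sym (negPf neq).
Qed.

(** Two orders that differ below position [k] differ last at some position
    [i >= k], and from there on they agree.  The entries [a] and [b] at that
    position are then ranked oppositely by the two orders. *)
Lemma last_disagreement k u v :
  drop k u != drop k v ->
  exists a b, [/\ a != b, k <= index a u, index a u = index b v,
                  index b u < index a u & index a v < index b v].
Proof.
set n := #|T|.
have [j] := ubnP (n - k); elim: j k => // j IHj k lt_j neq.
have [ge_k|lt_k] := leqP n k.
  by rewrite !drop_oversize ?size_lorder // in neq.
have [eqS|neqS] := eqVneq (drop k.+1 u) (drop k.+1 v); last first.
  have [|a [b [h1 h2 h3 h4 h5]]] := IHj k.+1 _ neqS; first by lia.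
  by exists a, b; split=> //; apply: ltnW.
have lu : k < size u by rewrite size_lorder.
have lv : k < size v by rewrite size_lorder.
have [x0 _|T0] := pickP T; last by rewrite /n eq_card0 in lt_k.
set a := nth x0 u k; set b := nth x0 v k.
have ia : index a u = k by rewrite index_uniq ?lorder_uniq.
have ib : index b v = k by rewrite index_uniq ?lorder_uniq.
have neq_ab : a != b.
  apply: contraNneq neq; rewrite (drop_nth x0 lu) (drop_nth x0 lv) eqS.
  by rewrite -/a -/b => ->.
have above (s t : lorder T) c d : index c s = k -> index d t = k -> c != d ->
    drop k.+1 s = drop k.+1 t -> index d s < k.
  move=> ic id neq_cd est; rewrite ltnNge leq_eqVlt negb_or.
  rewrite -{1}ic (inj_eq (@index_lorder_inj s)) neq_cd /= -leqNgt.
  rewrite leqNgt; apply/negP => lt_d.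
  have: d \in drop k.+1 s.
    rewrite -(nth_index d (mem_lorder s d)) -(subnKC lt_d) -nth_drop mem_nth //.
    by rewrite size_drop ltn_sub2r ?index_mem ?mem_lorder //
       (leq_ltn_trans lt_d) // index_mem mem_lorder.
  rewrite est => in_t; have := lorder_uniq t; rewrite -(cat_take_drop k.+1 t).
  rewrite cat_uniq => /and3P [_ /hasPn /(_ _ in_t) /=]; rewrite in_take ?mem_lorder //.
  by rewrite id ltnS leqnn.
exists a, b; split; rewrite ?ia ?ib //; first exact: (above u v a b).
by apply: (above v u b a) => //; rewrite eq_sym.
Qed.

(** The equal suffixes start at the same position because all orders have the
    same length. *)
Lemma index_drop_eq k u v x :
  drop k u = drop k v -> k <= index x u -> index x u = index x v.
Proof.
move=> e le_k.
have [le_ku|] := leqP k (size u); last first.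
  by rewrite size_lorder => /ltnW /leq_trans/(_ le_k); rewrite leqNgt index_lorder.
have le_kv : k <= size v by rewrite size_lorder -(size_lorder u).
have mem_k (s : lorder T) : k <= size s -> (x \in take k s) = (index x s < k).
  by move=> _; rewrite in_take // mem_lorder.
have xu : x \notin take k u by rewrite mem_k // -leqNgt.
have xd : x \in drop k v.
  have := mem_lorder u x; rewrite -{1}(cat_take_drop k u) mem_cat (negPf xu) /=.
  by rewrite e.
have xv : x \notin take k v.
  have := lorder_uniq v; rewrite -{1}(cat_take_drop k v) cat_uniq.
  by case/and3P=> _ /hasPn /(_ _ xd).
rewrite -(cat_take_drop k u) -(cat_take_drop k v) !index_cat.
by rewrite (negPf xu) (negPf xv) e !size_takel.
Qed.

End Orders.

(** * Never-bottom conditions and saturated domains *)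
Section Saturated.

Variable T : finType.
Implicit Types (u v w : lorder T) (D E : {set lorder T}) (x y z : T).

Definition last3 w x y z := prefers w y x && prefers w z x.

Definition never_last D x y z := [forall w in D, ~~ last3 w x y z].

Definition chain3 w x y z := prefers w x y && prefers w y z.

Definition arrow_triples D := forall x y z, uniq [:: x; y; z] ->
  [|| never_last D x y z, never_last D y x z | never_last D z x y].

(** The invariant of the recursion.  Being a maximal Condorcet domain cannot be
    propagated directly through an extension; these four conditions can, and
    they imply it.  Only two of the four rankings of a triple appear in
    [sat_triple]: exchanging [y] and [z] provides the two others.  The condition
    [sat_pair] serves to realise the triples that contain a new element. *)
Record saturated D : Prop := Saturated {
  sat_arrow : arrow_triples D;
  sat_pair : forall x y, x != y -> exists2 w, w \in D & prefers w x y;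
  sat_triple : forall x y z, uniq [:: x; y; z] -> never_last D x y z ->
    (exists2 w, w \in D & chain3 w x y z) /\
    (exists2 w, w \in D & chain3 w y x z);
  sat_closed : forall w,
    (forall x y z, uniq [:: x; y; z] -> never_last D x y z ->
       ~~ last3 w x y z) -> w \in D }.

Lemma uniq3P x y z : reflect [/\ x != y, x != z & y != z] (uniq [:: x; y; z]).
Proof.
rewrite /= !inE negb_or andbT -andbA; exact: and3P.
Qed.

Lemma last3C w x y z : last3 w x y z = last3 w x z y.
Proof. exact: andbC. Qed.

Lemma never_lastC D x y z : never_last D x y z = never_last D x z y.
Proof. by apply: eq_forallb => w; rewrite last3C. Qed.

Lemma never_lastP D x y z :
  reflect (forall w, w \in D -> ~~ last3 w x y z) (never_last D x y z).
Proof. exact: 'forall_implyP. Qed.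

Lemma ranks_last_set3 w x y z : x != y -> x != z ->
  ranks_last w [set x; y; z] x = last3 w x y z.
Proof.
move=> xy xz; rewrite /ranks_last /last3 !inE eqxx /=.
apply/forall_inP/andP => [h|[h1 h2] t].
  by split; [have := h y | have := h z];
    rewrite !inE eqxx ?orbT /= eq_sym ?xy ?xz /=; apply.
by rewrite !inE -orbA => /or3P [] /eqP->; rewrite ?eqxx ?h1 ?h2 ?implybT.
Qed.

Lemma never_bottom_set3 D x y z : x != y -> x != z ->
  never_bottom D [set x; y; z] x = never_last D x y z.
Proof.
move=> xy xz; rewrite /never_bottom !inE eqxx /=.
by apply: eq_forallb => w; rewrite ranks_last_set3.
Qed.

(** In a cyclic triple each of the three elements is ranked last once. *)
Lemma arrow_triples_condorcet D : arrow_triples D -> condorcet D.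
Proof.
move=> arr; apply/existsP => -[u /andP [uD /existsP [v /andP [vD /existsP [w]]]]].
case/andP=> wD /existsP [a /existsP [b /existsP [c /and4P []]]] abc.
case/andP=> u1 u2 /andP [v1 v2] /andP [w1 w2].
have tr (t : lorder T) x y z : prefers t x y -> prefers t y z -> prefers t x z.
  exact: ltn_trans.
case/or3P: (arr _ _ _ abc) => /never_lastP h.
- by have := h _ vD; rewrite /last3 v2 (tr _ _ _ _ v1 v2).
- by have := h _ wD; rewrite /last3 w2 (tr _ _ _ _ w1 w2).
- by have := h _ uD; rewrite /last3 u2 (tr _ _ _ _ u1 u2).
Qed.

Lemma arrow_single_peakedP D : reflect (arrow_triples D) (arrow_single_peaked D).
Proof.
apply: (iffP andP) => [[_ /forallP nb] x y z xyz|arr].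
  have /uniq3P [xy xz yz] := xyz.
  have card3 : #|[set x; y; z]| == 3.
    by rewrite -setUA cardsU1 cards2 !inE negb_or xy xz yz.
  have /existsP [t nbt] := implyP (nb [set x; y; z]) card3.
  have tS : t \in [set x; y; z] by case/andP: nbt.
  move: tS nbt; rewrite !inE -orbA => /or3P [] /eqP->.
  - by rewrite never_bottom_set3 // => ->.
  - have -> : [set x; y; z] = [set y; x; z] by rewrite (setUC [set x]).
    by rewrite never_bottom_set3 // 1?eq_sym // => ->; rewrite orbT.
  - have -> : [set x; y; z] = [set z; x; y] by rewrite setUC setUA.
    by rewrite never_bottom_set3 // 1?eq_sym // => ->; rewrite !orbT.
split; first exact: arrow_triples_condorcet.
apply/forallP => S; apply/implyP; have [[|x [|y [|z [|]]]] // xyz _] := cards_eqP.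
have -> : [set t in [:: x; y; z]] = [set x; y; z].
  by apply/setP => t; rewrite !inE orbA.
have /uniq3P [xy xz yz] := xyz.
apply/existsP; case/or3P: (arr _ _ _ xyz) => h.
- by exists x; rewrite never_bottom_set3.
- exists y; have -> : [set x; y; z] = [set y; x; z] by rewrite (setUC [set x]).
  by rewrite never_bottom_set3 // eq_sym.
- exists z; have -> : [set x; y; z] = [set z; x; y] by rewrite setUC setUA.
  by rewrite never_bottom_set3 // eq_sym.
Qed.

(** An order [w] outside a saturated domain breaks one of its conditions, say
    by ranking [y, z, x] with [x] never bottom.  The domain contains orders
    ranking [x, y, z] and [z, x, y], and these complete a cyclic triple with
    [w]. *)
Lemma saturated_max_arrow D : saturated D -> max_arrow D.
Proof.
move=> satD; apply/andP; split; first exact/arrow_single_peakedP/sat_arrow.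
apply/maxsetP; split; first exact/arrow_triples_condorcet/sat_arrow.
move=> E condE sDE; apply/eqP; rewrite eqEsubset sDE andbT.
apply/subsetP => w wE; apply: (sat_closed satD) => x y z + nl.
wlog wyz : y z nl / prefers w y z => [hw|] xyz.
  have /uniq3P [xy xz yz] := xyz.
  have [|] := boolP (prefers w y z); first by move=> ?; exact: hw.
  rewrite prefersN // => wzy; rewrite last3C; apply: hw => //.
    by rewrite never_lastC.
  by apply/uniq3P; split => //; rewrite eq_sym.
apply/negP => /andP [wyx wzx].
have xzy : uniq [:: x; z; y].
  by case/uniq3P: xyz => *; apply/uniq3P; split => //; rewrite eq_sym.
have [[u uD /andP [u1 u2]] _] := sat_triple satD xyz nl.
rewrite never_lastC in nl.
have [_ [v vD /andP [v1 v2]]] := sat_triple satD xzy nl.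
move/subsetP: sDE => sDE; case/negP: condE.
apply/existsP; exists u; rewrite sDE //=.
apply/existsP; exists w; rewrite wE /=.
apply/existsP; exists v; rewrite sDE //=.
apply/existsP; exists x; apply/existsP; exists y; apply/existsP; exists z.
by rewrite -/(uniq [:: x; y; z]) xyz u1 u2 wyz wzx v1 v2.
Qed.

(** A single order is a Condorcet domain, so the empty domain is not maximal. *)
Lemma max_arrow_nonempty D : max_arrow D -> exists w, w \in D.
Proof.
case/andP=> _ /maxsetP [_ maxD]; apply/set0Pn/negP => /eqP D0.
have [w _] := lorder_inhabited T.
have cond1 : condorcet [set w].
  apply: arrow_triples_condorcet => x y z /uniq3P [xy xz yz].
  have [|nl] := boolP (never_last [set w] x y z); first by [].
  have {nl} /andP [yx zx] : last3 w x y z.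
    have /forallPn [v] := nl; rewrite inE negb_imply negbK => /andP [/eqP-> //].
  apply/orP; right; apply/orP; left; apply/never_lastP => _ /set1P->.
  by rewrite /last3 negb_and prefersN // yx.
have := maxD _ cond1; rewrite D0 sub0set => /(_ isT) /setP /(_ w).
by rewrite !inE eqxx.
Qed.

Lemma max_arrow_triples D : max_arrow D -> arrow_triples D.
Proof. by case/andP=> /arrow_single_peakedP. Qed.

Lemma max_arrow_eq D E : max_arrow D -> condorcet E -> D \subset E -> D = E.
Proof. by case/andP=> _ /maxsetP [_ maxD] condE sDE; rewrite (maxD E). Qed.

End Saturated.

(** * Inserting an element in an order *)

(** Orders on the complement of [f] live on a type of their own, so that the
    notions above apply to them unchanged. *)
Notation minor f := {x | x != f}.

Section Insertion.

Variables (T : finType) (f : T).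
Implicit Types (w : lorder T) (u v q : lorder (minor f)) (a b : minor f).
Local Notation n := #|{: minor f}|.

Lemma card_minor : #|T| = n.+1.
Proof.
have <- : #|predC1 f| = n by rewrite card_sig; apply: eq_card.
by rewrite cardC1 prednK //; apply/card_gt0P; exists f.
Qed.

Let ins_seq k u : seq T := take k (map val u) ++ f :: drop k (map val u).

Lemma insert_size k u : size (ins_seq k u) == #|T|.
Proof.
by rewrite size_cat /= addnS -size_cat cat_take_drop size_map size_lorder card_minor.
Qed.

Lemma insert_uniq k u : uniq (Tuple (insert_size k u)).
Proof.
rewrite /= /ins_seq -cat1s uniq_catCA /= cat_take_drop.
rewrite map_inj_uniq ?lorder_uniq ?andbT //; last exact: val_inj.
by apply/mapP => -[[x /= neq] _ e]; rewrite e eqxx in neq.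
Qed.

Definition insert k u : lorder T := LOrder (insert_uniq k u).

Lemma index_insert_f k u : k <= n -> index f (insert k u) = k.
Proof.
move=> le_k; rewrite /= /ins_seq index_cat.
have f_notin : f \notin map val (u : seq _).
  by apply/mapP => -[[x /= neq] _ e]; rewrite e eqxx in neq.
have /negPf-> : f \notin take k (map val u) by apply: contra f_notin => /mem_take.
by rewrite /= eqxx addn0 size_takel // size_map size_lorder.
Qed.

Lemma index_insert k u a :
  k <= n -> index (val a) (insert k u) = bump k (index a u).
Proof.
move=> le_k; rewrite /= /ins_seq index_cat -map_take -map_drop.
rewrite mem_map ?in_take ?mem_lorder //=; last exact: val_inj.
rewrite index_map; last exact: val_inj.
have iu : index a u = index a (take k u ++ drop k u) by rewrite cat_take_drop.
rewrite /bump; have [lt_a|ge_a] := ltnP (index a u) k.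
  by rewrite iu index_cat in_take ?mem_lorder // lt_a.
rewrite add1n iu index_cat in_take ?mem_lorder // ltnNge ge_a /=.
rewrite eq_sym (negPf (valP a)) size_map !size_takel ?size_lorder //.
by rewrite index_map ?addnS //; apply: val_inj.
Qed.

Lemma prefers_insert k u a b :
  k <= n -> prefers (insert k u) (val a) (val b) = prefers u a b.
Proof. by move=> le_k; rewrite /prefers !index_insert // !ltnNge leq_bump2. Qed.

Lemma prefers_insert_fl k u a :
  k <= n -> prefers (insert k u) f (val a) = (k <= index a u).
Proof.
move=> le_k; rewrite /prefers index_insert // index_insert_f // /bump.
by case: (leqP k) => h; [rewrite ltnS h | rewrite ltnNge ltnW].
Qed.

Lemma prefers_insert_fr k u a :
  k <= n -> prefers (insert k u) (val a) f = (index a u < k).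
Proof.
move=> le_k; rewrite -prefersN ?prefers_insert_fl ?ltnNge //.
by rewrite eq_sym (valP a).
Qed.

Definition prefers_insertE := (prefers_insert, prefers_insert_fl, prefers_insert_fr).

Lemma insert_inj j k u v :
  j <= n -> k <= n -> insert j u = insert k v -> j = k /\ u = v.
Proof.
move=> le_j le_k e; have ejk : j = k.
  by rewrite -(index_insert_f u le_j) e index_insert_f.
split=> //; apply: eq_lorder => a.
apply: (can_inj (bumpK k)).
by rewrite -index_insert // -index_insert // -e ejk.
Qed.

(** Together with [insert_inj]: the orders on [T] are in bijection with the
    pairs of a position and an order on the complement of [f]. *)
Lemma insertP w : exists k u, k <= n /\ w = insert k u.
Proof.
have fw := mem_lorder w f.
set k := index f w; set r := take k w ++ drop k.+1 w.
have ew : w = take k w ++ f :: drop k.+1 w :> seq T.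
  by rewrite -{1}(nth_index f fw) -drop_nth ?index_mem // cat_take_drop.
have perm_w : perm_eq w (f :: r) by rewrite ew -cat1s perm_catCA.
have /andP [fr ur] : uniq (f :: r) by rewrite -(perm_uniq perm_w) lorder_uniq.
have sz_r : size r = n.
  by have /perm_size := perm_w; rewrite size_lorder card_minor => -[].
have val_r : map val (pmap insub r : seq (minor f)) = r.
  rewrite pmap_filter; last exact: insubK.
  apply/all_filterP/allP => x xr; rewrite isSome_insub.
  by apply: contraNneq fr => <-.
have [u eu] : exists u : lorder (minor f), u = pmap insub r :> seq _.
  apply: lorder_exists; first exact: pmap_sub_uniq.
  by rewrite -(size_map val) val_r.
have le_k : k <= n by rewrite -ltnS -card_minor; apply: index_lorder.
exists k, u; split=> //; apply: lorder_inj.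
have sz_k : size (take k w) = k by rewrite size_takel // ltnW // index_mem.
by rewrite /= /ins_seq eu val_r take_size_cat ?drop_size_cat.
Qed.

End Insertion.

(** * Extensions of a domain by a new terminal element *)
Section Extension.

Variables (T : finType) (f : T).
Implicit Types (w : lorder T) (u v q : lorder (minor f)) (a b c : minor f).
Implicit Types (D : {set lorder T}) (E : {set lorder (minor f)}).
Local Notation n := #|{: minor f}|.

(** As [u] and [q] have the same length, equality of their suffixes from
    position [k] says that what lies below [f] is a suffix of [q]. *)
Definition extension E q : {set lorder T} :=
  [set w | [exists k : 'I_n.+1, exists u : lorder (minor f),
    [&& w == insert k u, u \in E & drop k u == drop k q]]].

Lemma in_extension E q k u : k <= n ->
  (insert k u \in extension E q) = (u \in E) && (drop k u == drop k q).
Proof.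
move=> le_k; rewrite inE; apply/existsP/idP => [[[j /= lt_j]]|h]; last first.
  by exists (Ordinal (le_k : k < n.+1)); apply/existsP; exists u; rewrite eqxx.
case/existsP => v /andP [/eqP e h].
by have [-> ->] := insert_inj le_k (lt_j : j <= n) e.
Qed.

Lemma extensionP E q w :
  reflect (exists k u, [/\ k <= n, w = insert k u, u \in E & drop k u = drop k q])
          (w \in extension E q).
Proof.
apply: (iffP idP) => [|[k [u [le_k -> uE e]]]]; last first.
  by rewrite in_extension // uE e /=.
have [k [u [le_k ->]]] := insertP f w; rewrite in_extension //.
by case/andP=> uE /eqP e; exists k, u.
Qed.

Variant minor_spec : T -> Type :=
  | MinorPoint : minor_spec f
  | MinorVal a : minor_spec (val a).

Lemma minorP x : minor_spec x.
Proof.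
have [->|neq] := eqVneq x f; first exact: MinorPoint.
exact: (MinorVal (exist _ x neq)).
Qed.

Variables (E : {set lorder (minor f)}) (q : lorder (minor f)).
Hypotheses (satE : saturated E) (qE : q \in E).

Lemma insert_bottom_extension u : u \in E -> insert n u \in extension E q.
Proof. by move=> uE; rewrite in_extension // uE !drop_oversize ?size_lorder //=. Qed.

Lemma insert_base_extension k : k <= n -> insert k q \in extension E q.
Proof. by move=> le_k; rewrite in_extension // qE /=. Qed.

Lemma never_last_extension a b c :
  never_last (extension E q) (val a) (val b) (val c) = never_last E a b c.
Proof.
apply/never_lastP/never_lastP => [nl u uE|nl w].
  by have := nl _ (insert_bottom_extension uE); rewrite /last3 !prefers_insert.
case/extensionP => k [u [le_k -> uE _]].
by rewrite /last3 !prefers_insert //; exact: nl.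
Qed.

(** If [a] lies below [f], then the part below [f] is a suffix of [q] that
    contains [a], hence all that [q] ranks below [a].  Conversely [f] can be
    put on top of [q]. *)
Lemma never_last_extension_point a b : a != b ->
  never_last (extension E q) (val a) (val b) f = prefers q a b.
Proof.
move=> neq; apply/never_lastP/idP => [nl|qab w].
  have := nl _ (insert_base_extension (leq0n n)).
  by rewrite /last3 prefers_insert // prefers_insert_fl // andbT prefersN // eq_sym.
case/extensionP => k [u [le_k -> uE eku]]; apply/negP => /andP [].
rewrite prefers_insert // prefers_insert_fl // => uba ka.
have iau := index_drop_eq eku ka.
have kb : k <= index b q by rewrite (leq_trans ka) // iau ltnW.
have ibu := index_drop_eq (esym eku) kb.
by move: uba; rewrite /prefers -ibu iau ltnNge ltnW.
Qed.

Lemma uniq3_val a b c : uniq [:: val a; val b; val c] -> uniq [:: a; b; c].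
Proof. by rewrite -(map_inj_uniq val_inj). Qed.

(** The orders [q] with [f] inserted anywhere and those of [E] with [f] at the
    bottom realise the rankings that involve [f].  An order that satisfies all the
    conditions has a suffix of [q] below [f]: otherwise, at the last
    disagreement, an element [a] lies below both [f] and an element [b] that
    [q] ranks below [a]. *)
Lemma saturated_extension : saturated (extension E q).
Proof.
have neq_val a b : val a != val b -> a != b by apply: contra_neq => ->.
have qN a b : val a != val b -> prefers q a b || prefers q b a.
  by move/neq_val => ?; case: (boolP (prefers q a b)) => //; rewrite prefersN.
have nlp a b : val a != val b ->
    never_last (extension E q) (val a) (val b) f = prefers q a b.
  by move/neq_val; exact: never_last_extension_point.
split.
- move=> x y z; case: (minorP x) => [|a]; case: (minorP y) => [|b];
    case: (minorP z) => [|c]; rewrite ?eqxx //= => xyz; have /uniq3P [xy xz yz] := xyz;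
    rewrite ?eqxx // in xy xz yz.
  + by rewrite !(never_lastC _ _ f) !nlp ?qN ?orbT // eq_sym.
  + by rewrite (never_lastC _ _ f) !nlp // 1?eq_sym // orbCA qN ?orbT.
  + by rewrite !nlp // 1?eq_sym // orbA qN.
  + by rewrite !never_last_extension; apply: (sat_arrow satE); exact: uniq3_val.
- move=> x y; case: (minorP x) => [|a]; case: (minorP y) => [|b]; rewrite ?eqxx //.
  + exists (insert 0 q); first exact: insert_base_extension.
    by rewrite prefers_insert_fl.
  + exists (insert n q); first exact: insert_base_extension.
    by rewrite prefers_insert_fr // index_lorder.
  + move/neq_val => /(sat_pair satE) [u uE uab].
    by exists (insert n u); [exact: insert_bottom_extension | rewrite prefers_insert].
- have abf a b : val a != val b -> prefers q a b ->
      [/\ exists2 w, w \in extension E q & chain3 w (val a) (val b) f,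
          exists2 w, w \in extension E q & chain3 w (val b) (val a) f,
          exists2 w, w \in extension E q & chain3 w (val a) f (val b)
        & exists2 w, w \in extension E q & chain3 w f (val a) (val b)].
    move=> ab qab; split.
    + exists (insert n q); first exact: insert_base_extension.
      by rewrite /chain3 !prefers_insertE // qab index_lorder.
    + have [|u uE uba] := sat_pair satE (x := b) (y := a).
        by apply: neq_val; rewrite eq_sym.
      exists (insert n u); first exact: insert_bottom_extension.
      by rewrite /chain3 !prefers_insertE // uba index_lorder.
    + have lt_b := index_lorder q b.
      exists (insert (index b q) q); first by apply: insert_base_extension; exact: ltnW.
      by rewrite /chain3 !prefers_insertE ?(ltnW lt_b) // leqnn andbT.
    + exists (insert 0 q); first exact: insert_base_extension.
      by rewrite /chain3 !prefers_insertE.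
  move=> x y z; case: (minorP x) => [|a]; case: (minorP y) => [|b];
    case: (minorP z) => [|c]; rewrite ?eqxx //= => xyz; have /uniq3P [xy xz yz] := xyz;
    rewrite ?eqxx // in xy xz yz.
  + move/never_lastP => /(_ _ (insert_base_extension (leqnn n))).
    by rewrite /last3 !prefers_insertE // !index_lorder.
  + by rewrite never_lastC nlp // => /(abf _ _ xz) [].
  + by rewrite nlp // => /(abf _ _ xy) [].
  + rewrite never_last_extension => /(sat_triple satE (uniq3_val xyz)).
    case=> -[u uE u1] [v vE v1]; split.
      exists (insert n u); first exact: insert_bottom_extension.
      by rewrite /chain3 !prefers_insertE.
    exists (insert n v); first exact: insert_bottom_extension.
    by rewrite /chain3 !prefers_insertE.
- move=> w; have [k [u [le_k ->]]] := insertP f w => ok.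
  rewrite in_extension //; apply/andP; split.
    apply: (sat_closed satE) => a b c abc nl.
    have := ok (val a) (val b) (val c).
    rewrite never_last_extension /last3 !prefers_insertE //.
    by apply=> //; rewrite -(map_inj_uniq val_inj) in abc.
  apply/negPn/negP => /last_disagreement [a [b [ab ka iab uba qab]]].
  have vab : val a != val b by rewrite (inj_eq val_inj).
  have /negP[] : ~~ last3 (insert k u) (val a) (val b) f.
    apply: ok; last by rewrite nlp.
    by apply/uniq3P; split; rewrite // ?(valP a) ?(valP b).
  by rewrite /last3 !prefers_insertE // ka andbT.
Qed.

End Extension.

(** * Every maximal domain is an extension *)
Section Ends.

Variables (T : finType) (f : T).
Implicit Types (u v q : lorder (minor f)) (a : minor f).
Local Notation n := #|{: minor f}|.

Lemma ends_at_insert_f k u : k <= n -> ends_at (insert k u) f = (k == n).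
Proof. by move=> le_k; rewrite ends_atE index_insert_f // (card_minor f). Qed.

Lemma ends_at_insert k u a :
  k <= n -> ends_at (insert k u) (val a) = (k < n) && ends_at u a.
Proof.
move=> le_k; rewrite !ends_atE index_insert // (card_minor f) /=.
move: (index_lorder u a) le_k; rewrite /bump; move: (index a u) => i; move: #|_| => m.
by case: (leqP k i) => /=; lia.
Qed.

Lemma starts_at_insert_f k u : k <= n -> starts_at (insert k u) f = (k == 0).
Proof. by move=> le_k; rewrite starts_atE index_insert_f. Qed.

Lemma starts_at_insert k u a :
  k <= n -> starts_at (insert k u) (val a) = (0 < k) && starts_at u a.
Proof.
move=> le_k; rewrite !starts_atE index_insert // /bump.
by case: k {le_k} => [|k] //=; case: (index a u) => [|i]; rewrite ?addn_eq0 ?andbF.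
Qed.

End Ends.

Section FirstAndLast.

Variable T : finType.
Implicit Types (w : lorder T) (x y : T).

Lemma starts_at_inj w x y : starts_at w x -> starts_at w y -> x = y.
Proof.
by rewrite !starts_atE => /eqP ex /eqP ey; apply: (@index_lorder_inj _ w); rewrite ex.
Qed.

Lemma ends_at_inj w x y : ends_at w x -> ends_at w y -> x = y.
Proof.
by rewrite !ends_atE => /eqP ex /eqP ey; apply: (@index_lorder_inj _ w); rewrite ex.
Qed.

Lemma index_surj w k : k < #|T| -> exists x, index x w = k.
Proof.
move=> lt_k; have /card_gt0P [x0 _] : 0 < #|T| by apply: leq_ltn_trans lt_k.
by exists (nth x0 w k); rewrite index_uniq ?size_lorder ?lorder_uniq.
Qed.

Lemma starts_at_exists w : 0 < #|T| -> exists x, starts_at w x.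
Proof. by case/(index_surj w)=> x ex; exists x; rewrite starts_atE ex. Qed.

Lemma ends_at_exists w : 0 < #|T| -> exists x, ends_at w x.
Proof.
move=> T_gt0; have [|x ex] := @index_surj w #|T|.-1; first by rewrite prednK.
by exists x; rewrite ends_atE ex.
Qed.

Lemma start_neq_end w x y : 1 < #|T| -> starts_at w x -> ends_at w y -> x != y.
Proof.
rewrite starts_atE ends_atE => T_gt1 /eqP ex /eqP ey; apply: contraTneq T_gt1 => exy.
by rewrite -exy ex in ey; rewrite -leqNgt; move: ey; case: #|T| => [|[]].
Qed.

Lemma terminalP (D : {set lorder T}) x :
  reflect (exists2 w, w \in D & ends_at w x) (terminal D x).
Proof. exact: exists_inP. Qed.

End FirstAndLast.

(** The base case of the recursion. *)
Lemma saturated_setT (T : finType) : #|T| <= 1 -> saturated [set: lorder T].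
Proof.
move/card_le1_eqP => T1; have eqT (x y : T) : x = y by exact: T1.
by split=> [x y z|x y|x y z|w _]; rewrite ?inE //= ?(eqT y x) ?inE ?eqxx.
Qed.

(** Take for [q] the order obtained by removing [f] from an order of [D] with
    the longest part below [f].  If another order of [D] had below [f] something
    else than a suffix of [q], the last disagreement with [q] would give two
    elements [a] and [b], each of them last among [a, b, f] in one of the two
    orders.  In an order ending with [f], it is [f]
    which is last of the three. *)
Lemma arrow_sub_extension (T : finType) (f : T) (D : {set lorder T}) :
    (forall D' : {set lorder (minor f)}, arrow_triples D' -> D' != set0 ->
       exists2 E, saturated E & D' \subset E) ->
    arrow_triples D -> terminal D f ->
  exists E (q : lorder (minor f)),
    [/\ saturated E, q \in E & D \subset extension E q].
Proof.
set n := #|{: minor f}| => subsat arrD /terminalP [w0 w0D w0f].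
pose D' := [set u : lorder (minor f) | [exists k : 'I_n.+1, insert k u \in D]].
have D'_in k u : k <= n -> insert k u \in D -> u \in D'.
  by rewrite -ltnS inE => lt_k kuD; apply/existsP; exists (Ordinal lt_k).
have arrD' : arrow_triples D'.
  move=> a b c abc.
  have nl x y z : never_last D (val x) (val y) (val z) -> never_last D' x y z.
    move/never_lastP => nl; apply/never_lastP => u; rewrite inE.
    case/existsP=> -[k /= lt_k] kuD; have := nl _ kuD.
    by rewrite /last3 !prefers_insert.
  have := arrD (val a) (val b) (val c); rewrite -(map_inj_uniq val_inj) in abc.
  by move=> /(_ abc) /or3P [] /nl ->; rewrite ?orbT.
(* The smallest position of [f] leaves the longest part below it. *)
have [w wD min_w] : exists2 w, w \in D & forall v, v \in D -> index f w <= index f v.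
  by case: (arg_minnP (fun w : lorder T => index f w) w0D) => w; exists w.
have [k [q [le_k ew]]] := insertP f w; rewrite {w}ew in wD min_w.
rewrite index_insert_f // in min_w.
have qD' : q \in D' by exact: D'_in wD.
have [|E satE sD'E] := subsat D' arrD'; first by apply/set0Pn; exists q.
exists E, q; split=> //; first exact: subsetP qD'.
apply/subsetP => v vD; have [j [u [le_j ev]]] := insertP f v.
rewrite {v}ev in vD *; have := min_w _ vD; rewrite index_insert_f // => le_kj.
rewrite in_extension // (subsetP sD'E) /=; last exact: D'_in vD.
apply/negPn/negP => /last_disagreement [a [b [ab ja iab uba qab]]].
have abf : uniq [:: val a; val b; f].
  by apply/uniq3P; rewrite (inj_eq val_inj) (valP a) (valP b).
case/or3P: (arrD _ _ _ abf) => /never_lastP nl.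
- have := nl _ vD; rewrite /last3 !prefers_insertE //.
  by rewrite ja /prefers uba.
- have := nl _ wD; rewrite /last3 !prefers_insertE // /prefers qab /=.
  by rewrite -iab (leq_trans le_kj).
- have [i [r [le_i er]]] := insertP f w0; rewrite {w0}er in w0D w0f.
  have := nl _ w0D; rewrite ends_at_insert_f // in w0f.
  by rewrite /last3 !prefers_insertE // (eqP w0f) !index_lorder.
Qed.

Lemma arrow_sub_saturated (T : finType) (D : {set lorder T}) :
  arrow_triples D -> D != set0 -> exists2 E, saturated E & D \subset E.
Proof.
have [m] := ubnP #|T|; elim: m T D => // m IHm T D lt_m arrD /set0Pn [w wD].
have [T0|T_gt0] := posnP #|T|.
  exists [set: lorder T]; first by apply: saturated_setT; rewrite T0.
  exact: subsetT.
have [f wf] := ends_at_exists w T_gt0.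
have Df : terminal D f by apply/terminalP; exists w.
have [|E [q [satE qE sDE]]] := arrow_sub_extension _ arrD Df.
  by move=> D'; apply: IHm; rewrite (card_minor f) in lt_m.
by exists (extension E q) => //; exact: saturated_extension.
Qed.

Lemma max_arrow_saturated (T : finType) (D : {set lorder T}) :
  max_arrow D <-> saturated D.
Proof.
split; last exact: saturated_max_arrow.
move=> maxD; have [w wD] := max_arrow_nonempty maxD.
have [|E satE sDE] := arrow_sub_saturated (max_arrow_triples maxD).
  by apply/set0Pn; exists w.
by rewrite (max_arrow_eq maxD _ sDE) //; exact/arrow_triples_condorcet/sat_arrow.
Qed.

(** The structure theorem, which applies to either terminal element of the
    domain. *)
Lemma max_arrow_extension (T : finType) (f : T) (D : {set lorder T}) :
    max_arrow D -> terminal D f ->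
  exists E (q : lorder (minor f)), [/\ max_arrow E, q \in E & D = extension E q].
Proof.
move=> maxD Df.
have [|E [q [satE qE sDE]]] := arrow_sub_extension _ (max_arrow_triples maxD) Df.
  by move=> D'; exact: arrow_sub_saturated.
exists E, q; split=> //; first exact/max_arrow_saturated.
apply: max_arrow_eq => //; apply: arrow_triples_condorcet.
exact/sat_arrow/saturated_extension.
Qed.

Lemma extension_max_arrow (T : finType) (f : T) (E : {set lorder (minor f)}) q :
  max_arrow E -> q \in E -> max_arrow (extension E q).
Proof.
by move=> /max_arrow_saturated satE qE; apply/max_arrow_saturated/saturated_extension.
Qed.

(** * Terminal elements and extremal paths *)
Section ExtensionEnds.

Variables (T : finType) (f : T) (E : {set lorder (minor f)}) (q : lorder (minor f)).
Hypothesis qE : q \in E.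
Local Notation n := #|{: minor f}|.

(** When [f] is not last, the part below [f] is a nonempty suffix of [q] and
    ends where [q] ends. *)
Lemma terminal_extension_val (a : minor f) :
  terminal (extension E q) (val a) = ends_at q a.
Proof.
apply/terminalP/idP => [[w /extensionP [k [u [le_k -> uE eku]]]]|qa].
  rewrite ends_at_insert // => /andP [lt_k]; rewrite !ends_atE => ua.
  rewrite -(index_drop_eq eku) // (eqP ua) -ltnS prednK //.
  exact: leq_ltn_trans lt_k.
exists (insert 0 q); first exact: insert_base_extension.
by rewrite ends_at_insert // qa andbT; apply/card_gt0P; exists a.
Qed.

Lemma extension_start w : w \in extension E q -> starts_at w f -> w = insert 0 q.
Proof.
case/extensionP=> k [u [le_k -> uE eku]]; rewrite starts_at_insert_f // => /eqP k0.
by rewrite k0 !drop0 in eku *; rewrite (lorder_inj eku).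
Qed.

End ExtensionEnds.

Section Extremal.

Variable T : finType.
Hypothesis T_gt1 : 1 < #|T|.
Implicit Types (D : {set lorder T}) (w p : lorder T) (s f x : T).

Lemma max_arrow_start D f : max_arrow D -> terminal D f ->
  exists w s, [/\ w \in D, starts_at w f, ends_at w s,
                  forall v, v \in D -> starts_at v f -> v = w
                & forall x, terminal D x -> x = f \/ x = s].
Proof.
move=> maxD Df; have [E [q [maxE qE ->]]] := max_arrow_extension maxD Df.
have n_gt0 : 0 < #|{: minor f}| by rewrite -ltnS -card_minor.
have [a qa] := ends_at_exists q n_gt0.
exists (insert 0 q), (val a); split.
- exact: insert_base_extension.
- by rewrite starts_at_insert_f.
- by rewrite ends_at_insert // n_gt0.
- by move=> v; exact: extension_start.
- move=> x; case: (minorP f x) => [|b]; first by left.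
  by rewrite terminal_extension_val // => /(ends_at_inj qa) ->; right.
Qed.

Lemma extremal_from_toP D s f w :
  reflect [/\ w \in D, starts_at w s, ends_at w f & terminal D s]
          (extremal_from_to D s f w).
Proof.
apply: (iffP and5P) => [[_ Ds _ wD /andP [ws wf]] //|[wD ws wf Ds]].
rewrite ws wf; split=> //; first exact: start_neq_end ws wf.
by apply/terminalP; exists w.
Qed.

Lemma extremalP D w :
  reflect (exists s f, extremal_from_to D s f w) (extremal D w).
Proof.
by apply: (iffP existsP) => [[s /existsP [f ?]]|[s [f ?]]]; exists s;
  [exists f | apply/existsP; exists f].
Qed.

Lemma max_arrow_extremal D : max_arrow D -> exists w, extremal D w.
Proof.
move=> maxD; have [w wD] := max_arrow_nonempty maxD.
have [f wf] := ends_at_exists w (ltnW T_gt1).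
have Df : terminal D f by apply/terminalP; exists w.
have [v [s [vD vf vs _ _]]] := max_arrow_start maxD Df.
by exists v; apply/extremalP; exists f, s; apply/extremal_from_toP.
Qed.

(** An extremal path is determined by its first element, by [max_arrow_start]
    applied to each of the two terminal elements. *)
Lemma extremal_pair D p s f : max_arrow D -> extremal_from_to D s f p ->
  exists2 q, extremal_from_to D f s q &
    forall s' f' w, extremal_from_to D s' f' w ->
      [/\ s' = s, f' = f & w = p] \/ [/\ s' = f, f' = s & w = q].
Proof.
move=> maxD spf; have /and5P [sf Ds Df pD /andP [ps pf]] := spf.
have [p' [f1 [_ _ p'f uni_p term_sf]]] := max_arrow_start maxD Ds.
have ep := uni_p _ pD ps; rewrite -{p'}ep in p'f uni_p.
rewrite -{f1 p'f}(ends_at_inj pf p'f) in term_sf.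
have [q [s1 [qD qf qs uni_q term_fs]]] := max_arrow_start maxD Df.
have es : s = s1 by case: (term_fs _ Ds) sf => // ->; rewrite eqxx.
rewrite -{s1}es in qs term_fs.
have fqs : extremal_from_to D f s q by apply/extremal_from_toP.
exists q => // s' f' w /and5P [_ Ds' _ wD /andP [ws' wf']].
case: (term_sf _ Ds') => es'; subst s'.
  have ew := uni_p _ wD ws'; rewrite ew in wf'.
  by left; rewrite (ends_at_inj wf' pf).
have ew := uni_q _ wD ws'; rewrite ew in wf'.
by right; rewrite (ends_at_inj wf' qs).
Qed.

End Extremal.

(** * Counting the orders of a maximal domain *)
Lemma lorder_subsingleton (T : finType) (u v : lorder T) : #|T| <= 1 -> u = v.
Proof.
move=> T1; apply: eq_lorder => x.
by have := index_lorder u x; have := index_lorder v x; lia.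
Qed.

(** Nothing lies below [f] in these orders, so agreement with [q] is no
    constraint. *)
Lemma card_extension_ending (T : finType) (f : T) (E : {set lorder (minor f)}) q :
  #|[set w in extension E q | ends_at w f]| = #|E|.
Proof.
set n := #|{: minor f}|.
have -> : [set w in extension E q | ends_at w f] = insert n @: E.
  apply/setP => w; rewrite inE; apply/andP/imsetP => [[]|[u uE ->]].
    case/extensionP=> k [u [le_k -> uE _]]; rewrite ends_at_insert_f // => /eqP ->.
    by exists u.
  by rewrite insert_bottom_extension // ends_at_insert_f.
by rewrite card_imset // => u v /insert_inj [].
Qed.

Lemma card_max_arrow_rec (T : finType) (D : {set lorder T}) f :
    (forall E : {set lorder (minor f)}, max_arrow E ->
       #|E| = 2 ^ #|{: minor f}|.-1) ->
    max_arrow D -> terminal D f ->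
  #|[set w in D | ends_at w f]| = 2 ^ (#|T| - 2).
Proof.
move=> cardE maxD Df; have [E [q [maxE qE ->]]] := max_arrow_extension maxD Df.
by rewrite card_extension_ending cardE // (card_minor f) subSS subn1.
Qed.

(** Each of the two terminal elements is last in [2 ^ (#|T| - 2)] orders, by the
    structure theorem applied to that element. *)
Lemma card_max_arrow (T : finType) (D : {set lorder T}) :
  max_arrow D -> #|D| = 2 ^ #|T|.-1.
Proof.
have [m] := ubnP #|T|; elim: m T D => // m IHm T D lt_m maxD.
have [w wD] := max_arrow_nonempty maxD.
have [T1|T_gt1] := leqP #|T| 1.
  have -> : D = [set w].
    by apply/setP => v; rewrite (lorder_subsingleton v w T1) wD inE eqxx.
  by rewrite cards1; case: #|T| T1 => [|[]].
have IH (x : T) (E : {set lorder (minor x)}) :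
    max_arrow E -> #|E| = 2 ^ #|{: minor x}|.-1.
  by apply: IHm; rewrite (card_minor x) in lt_m.
have [p /extremalP [s [f sfp]]] := max_arrow_extremal T_gt1 maxD.
have /and5P [sf Ds Df _ _] := sfp.
have [v [s' [_ _ _ _ term_sf]]] := max_arrow_start T_gt1 maxD Df.
have es : s = s' by case: (term_sf _ Ds) sf => // ->; rewrite eqxx.
rewrite -{s'}es in term_sf.
have -> : D = [set w in D | ends_at w s] :|: [set w in D | ends_at w f].
  apply/setP => u; rewrite !inE -andb_orr; case: (boolP (u \in D)) => //= uD.
  have [x ux] := ends_at_exists u (ltnW T_gt1).
  have /term_sf [<-|<-] : terminal D x by apply/terminalP; exists u.
    by rewrite ux orbT.
  by rewrite ux.
rewrite cardsU disjoint_setI0; last first.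
  apply/pred0P => u; rewrite /= !inE; apply/negP => /andP [/andP [_ us] /andP [_ uf]].
  by rewrite (ends_at_inj us uf) eqxx in sf.
rewrite cards0 subn0 !(card_max_arrow_rec (IH _)) //.
by rewrite addnn -mul2n -expnS -subSn ?subSS ?subn1.
Qed.

Lemma card_max_arrow_ending (T : finType) (D : {set lorder T}) f :
  max_arrow D -> terminal D f -> #|[set w in D | ends_at w f]| = 2 ^ (#|T| - 2).
Proof. by apply: card_max_arrow_rec => E; exact: card_max_arrow. Qed.

(** * Domains with a prescribed extremal path *)

(** Unlike [extremal], this allows the two ends of [p] to coincide, so that the
    recurrence can start from the domain on one element. *)
Definition pinned (T : finType) (p : lorder T) : {set {set lorder T}} :=
  [set D | [&& max_arrow D, p \in D & [exists s, starts_at p s && terminal D s]]].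

Lemma pinnedP (T : finType) (p : lorder T) D :
  reflect [/\ max_arrow D, p \in D & exists2 s, starts_at p s & terminal D s]
          (D \in pinned p).
Proof.
rewrite inE; apply: (iffP and3P) => -[maxD pD]; first by move/exists_inP.
by move=> ?; split=> //; apply/exists_inP.
Qed.

Lemma pinnedE (T : finType) (p : lorder T) : 1 < #|T| ->
  pinned p = [set D | max_arrow D && extremal D p].
Proof.
move=> T_gt1; apply/setP => D; rewrite [RHS]inE.
apply/pinnedP/andP => [[maxD pD [s ps Ds]]|[maxD /extremalP [s [f]]]].
  split=> //; have [f pf] := ends_at_exists p (ltnW T_gt1).
  by apply/extremalP => //; exists s, f; apply/extremal_from_toP.
by case/extremal_from_toP => // pD ps _ Ds; split=> //; exists s.
Qed.

Section PinnedRecurrence.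

Variables (T : finType) (f : T).
Local Notation n := #|{: minor f}|.
Implicit Types (E : {set lorder (minor f)}) (q : lorder (minor f)).

Lemma extension_inj E1 E2 q1 q2 : q1 \in E1 -> q2 \in E2 ->
  extension E1 q1 = extension E2 q2 -> E1 = E2 /\ q1 = q2.
Proof.
move=> q1E q2E e; split.
  apply/setP => u; have := in_extension E1 q1 u (leqnn n).
  by rewrite e in_extension // !drop_oversize ?size_lorder // eqxx !andbT.
have := insert_base_extension q1E (leq0n n).
by rewrite e in_extension // !drop0 => /andP [_ /eqP/lorder_inj].
Qed.

(** The start of the path has to be a terminal element of the extension, which
    means that it is the last element of [q]. *)
Lemma pinned_insert (p : lorder (minor f)) s : starts_at p s ->
  pinned (insert n p) =
  [set extension x.1 x.2 | x in
    [set x : {set lorder (minor f)} * lorder (minor f) |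
      (x.1 \in pinned p) && (x.2 \in [set q in x.1 | ends_at q s])]].
Proof.
move=> ps; have n_gt0 : 0 < n by apply/card_gt0P; exists s.
have ps' : starts_at (insert n p) (val s) by rewrite starts_at_insert // n_gt0.
apply/setP => D; apply/pinnedP/imsetP => [[maxD pD [t pt Dt]]|[[E q]]].
  have Df : terminal D f.
    by apply/terminalP; exists (insert n p); rewrite // ends_at_insert_f.
  have [E [q [maxE qE eD]]] := max_arrow_extension maxD Df.
  rewrite -{t pt}(starts_at_inj ps' pt) eD terminal_extension_val // in Dt.
  exists (E, q) => //; rewrite in_set; apply/andP; split; last by rewrite in_set qE.
  apply/pinnedP.
  move: pD; rewrite eD in_extension // => /andP [pE _].
  by split=> //; exists s => //; apply/terminalP; exists q.
rewrite in_set => /andP [/pinnedP [/= maxE pE _]]; rewrite in_set => /andP [qE qs] ->.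
split; first exact: extension_max_arrow.
  exact: insert_bottom_extension.
by exists (val s); rewrite // terminal_extension_val.
Qed.

(** The order [q] ranges over the half of [E] that ends at a given terminal
    element.  For [n = 1] there is one choice, in accordance with the truncated
    subtraction. *)
Lemma card_pinned_insert (p : lorder (minor f)) : 0 < n ->
  #|pinned (insert n p)| = #|pinned p| * 2 ^ (n - 2).
Proof.
move=> n_gt0; have [s ps] := starts_at_exists p n_gt0.
rewrite (pinned_insert ps) card_in_imset => [|[E1 q1] [E2 q2]]; last first.
  rewrite !inE /= => /andP [_ /andP [q1E _]] /andP [_ /andP [q2E _]].
  by case/(extension_inj q1E q2E)=> -> ->.
rewrite -sum1_card (eq_bigl _ _ (fun x => in_set _ x)).
rewrite -(pair_big_dep (mem (pinned p))
            (fun E q => q \in [set q in E | ends_at q s]) (fun _ _ => 1)) /=.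
rewrite -sum_nat_const; apply: eq_bigr => E /pinnedP [maxE pE [t pt Et]].
rewrite -{t pt}(starts_at_inj ps pt) in Et.
by rewrite sum1_card card_max_arrow_ending.
Qed.

End PinnedRecurrence.

Lemma card_pinned (T : finType) (p : lorder T) : 0 < #|T| ->
  #|pinned p| = 2 ^ 'C(#|T| - 2, 2).
Proof.
have [m] := ubnP #|T|; elim: m T p => // m IHm T p lt_m T_gt0.
have [T1|T_gt1] := leqP #|T| 1.
  have -> : pinned p = [set [set: lorder T]].
    apply/setP => D; rewrite in_set1; apply/pinnedP/eqP => [[_ pD _]|->].
      by apply/setP => v; rewrite (lorder_subsingleton v p T1) pD inE.
    have [s ps] := starts_at_exists p T_gt0.
    split; rewrite ?inE //; first exact/max_arrow_saturated/saturated_setT.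
    exists s => //; apply/terminalP; exists p; rewrite ?inE // ends_atE.
    by have := index_lorder p s; lia.
  by rewrite cards1 (_ : #|T| - 2 = 0) //; lia.
have [f pf] := ends_at_exists p T_gt0.
have [k [u [le_k ep]]] := insertP f p; rewrite {p}ep in pf *.
rewrite ends_at_insert_f // in pf; rewrite (eqP pf) {k pf le_k}.
have n_gt0 : 0 < #|{: minor f}| by rewrite -ltnS -card_minor.
rewrite card_pinned_insert // IHm //; last by rewrite (card_minor f) in lt_m.
rewrite (card_minor f) -expnD; congr (2 ^ _); case: #|_| n_gt0 => [|[|n]] // _.
by rewrite !subSS !subn0 binS bin1.
Qed.

Lemma num_P_eq (T : finType) (p : lorder T) : 1 < #|T| ->
  num_P p = 2 ^ 'C(#|T| - 2, 2).
Proof. by move=> T_gt1; rewrite /num_P -pinnedE // card_pinned // ltnW. Qed.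

(** * Equivalence classes and involutions *)
Section Classes.

Variables (U : finType) (R : rel U).
Hypothesis eqR : equivalence_rel R.

Lemma equivalence_partitionT (X : {set U}) :
  partition (equivalence_partition R X) X.
Proof. by apply: equivalence_partitionP => x y z _ _ _; exact: eqR. Qed.

Lemma card_classes_sub (M X : {set U}) :
    X \subset M -> (forall x, x \in M -> exists2 y, y \in X & R x y) ->
  #|equivalence_partition R M| = #|equivalence_partition R X|.
Proof.
move=> /subsetP sXM meet.
have Rl x y z : R x y -> R x z = R y z by move=> xy; exact: (eqR x y z).2.
have Rxx x : R x x by exact: (eqR x x x).1.
have -> : equivalence_partition R X = (fun B => B :&: X) @: equivalence_partition R M.
  apply/setP => B; apply/imsetP/imsetP => [[x xX ->]|[_ /imsetP [x xM ->] ->]].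
    exists [set y in M | R x y]; first by apply/imsetP; exists x; rewrite ?sXM.
    apply/setP => y; rewrite !inE; case: (boolP (y \in X)) => [yX|].
      by rewrite sXM ?andbT.
    by rewrite andbF.
  have [y yX xy] := meet x xM; exists y => //; apply/setP => z.
  rewrite !inE -(Rl _ _ _ xy).
  by case: (boolP (z \in X)) => [zX|]; rewrite ?andbF // sXM ?andbT.
rewrite card_in_imset // => _ _ /imsetP [x xM ->] /imsetP [x' x'M ->] /setP e.
have [y yX xy] := meet x xM; have := e y; rewrite !inE yX xy sXM //= andbT => /esym x'y.
by apply/setP => z; rewrite !inE (Rl _ _ _ xy) (Rl _ _ _ x'y).
Qed.

(** Both sides sum [1 + (sigma x == x)] over [X]: the sum over a class is [2],
    whether the class is a pair or a fixed point. *)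
Lemma card_involution_classes (X : {set U}) (sigma : U -> U) :
    {in X, forall x, sigma x \in X} -> {in X, involutive sigma} ->
    {in X &, forall x y, R x y = (y == x) || (y == sigma x)} ->
  2 * #|equivalence_partition R X| = #|X| + #|[set x in X | sigma x == x]|.
Proof.
move=> sX sK RX; have partX := equivalence_partitionT X.
have -> : #|[set x in X | sigma x == x]| = \sum_(x in X) (sigma x == x : nat).
  rewrite -sum1_card big_mkcond [RHS]big_mkcond; apply: eq_bigr => x _.
  by rewrite inE; case: (x \in X); case: eqP.
rewrite -(sum1_card (mem X)) -big_split /= (set_partition_big _ partX).
rewrite mulnC -sum_nat_const.
apply: eq_bigr => _ /imsetP [x xX ->].
have -> : [set y in X | R x y] = [set x; sigma x].
  apply/setP => y; rewrite !inE; case: (boolP (y \in X)) => [yX|yX]; first exact: RX.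
  by apply/esym/negP => /orP [] /eqP ey; rewrite ey ?sX ?xX in yX.
have [fix_x|move_x] := eqVneq (sigma x) x.
  by rewrite fix_x setUid big_set1 fix_x eqxx.
rewrite big_setU1 /=; last by rewrite inE eq_sym.
by rewrite big_set1 sK // [x == _]eq_sym !(negPf move_x).
Qed.

End Classes.

(** * The action of permutations on domains *)
Section Action.

Variable T : finType.
Implicit Types (t u : {perm T}) (w p : lorder T) (D : {set lorder T}) (x y s f : T).
Local Open Scope group_scope.

Lemma index_path_image t w x : index (t x) (path_image t w) = index x w.
Proof. by rewrite /= index_map //; exact: perm_inj. Qed.

Lemma prefers_path_image t w x y :
  prefers (path_image t w) (t x) (t y) = prefers w x y.
Proof. by rewrite /prefers !index_path_image. Qed.

Lemma path_image1 w : path_image 1 w = w.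
Proof. by apply: eq_lorder => x; rewrite -{1}[x]perm1 index_path_image. Qed.

Lemma path_imageM t u w : path_image (t * u) w = path_image u (path_image t w).
Proof.
by apply: lorder_inj; rewrite /= -map_comp; apply: eq_map => x; rewrite /= permM.
Qed.

Lemma path_imageK t : cancel (path_image t) (path_image t^-1).
Proof. by move=> w; rewrite -path_imageM mulgV path_image1. Qed.

Lemma path_imageVK t : cancel (path_image t^-1) (path_image t).
Proof. by move=> w; rewrite -path_imageM mulVg path_image1. Qed.

Lemma path_image_transitive p w : exists t, path_image t p = w.
Proof.
have [T0|/card_gt0P [x0 _]] := posnP #|T|.
  by exists 1; apply: lorder_subsingleton; rewrite T0.
have lt_p x : index x p < size w by rewrite size_lorder index_lorder.
have inj : injective (fun x => nth x0 w (index x p)).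
  move=> x y /eqP; rewrite nth_uniq ?lorder_uniq // => /eqP.
  exact: index_lorder_inj.
exists (perm inj); apply: lorder_inj; apply: (@eq_from_nth _ x0).
  by rewrite !size_lorder.
move=> i; rewrite size_lorder => lt_i; rewrite /= (nth_map x0) ?size_lorder //.
by rewrite permE index_uniq ?lorder_uniq // size_lorder.
Qed.

Lemma path_image_free p t u : path_image t p = path_image u p -> t = u.
Proof.
move=> e; apply/permP => x; apply: (@index_lorder_inj _ (path_image u p)).
by rewrite -{1}e !index_path_image.
Qed.

Lemma mem_domain_image t D w :
  (w \in domain_image t D) = (path_image t^-1 w \in D).
Proof.
apply/imsetP/idP => [[v vD ->]|wD]; first by rewrite path_imageK.
by exists (path_image t^-1 w); rewrite ?path_imageVK.
Qed.

Lemma domain_image1 D : domain_image 1 D = D.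
Proof. by apply/setP => w; rewrite mem_domain_image invg1 path_image1. Qed.

Lemma domain_imageM t u D :
  domain_image (t * u) D = domain_image u (domain_image t D).
Proof. by apply/setP => w; rewrite !mem_domain_image invMg path_imageM. Qed.

Lemma domain_imageK t : cancel (domain_image t) (domain_image t^-1).
Proof. by move=> D; rewrite -domain_imageM mulgV domain_image1. Qed.

Lemma saturated_image t D : saturated D -> saturated (domain_image t D).
Proof.
have prefV w x y : prefers (path_image t^-1 w) x y = prefers w (t x) (t y).
  by rewrite -(prefers_path_image t) path_imageVK.
have nl D' x y z :
    never_last (domain_image t D') (t x) (t y) (t z) = never_last D' x y z.
  apply/never_lastP/never_lastP => nlD w.
    move=> wD; have := nlD (path_image t w).
    by rewrite mem_domain_image path_imageK /last3 !prefers_path_image; apply.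
  by rewrite mem_domain_image => /nlD; rewrite /last3 !prefV.
have uniqt x y z : uniq [:: t x; t y; t z] = uniq [:: x; y; z].
  by rewrite -[RHS](map_inj_uniq (@perm_inj _ t)).
move=> satD; split.
- move=> x y z; rewrite -(permKV t x) -(permKV t y) -(permKV t z) uniqt !nl.
  exact: (sat_arrow satD).
- move=> x y; rewrite -(permKV t x) -(permKV t y) (inj_eq perm_inj).
  case/(sat_pair satD)=> w wD wxy; exists (path_image t w).
    by rewrite mem_domain_image path_imageK.
  by rewrite prefers_path_image.
- move=> x y z; rewrite -(permKV t x) -(permKV t y) -(permKV t z) uniqt !nl => xyz.
  case/(sat_triple satD xyz)=> -[v vD v3] [w wD w3].
  by split; [exists (path_image t v) | exists (path_image t w)];
    rewrite ?mem_domain_image ?path_imageK // /chain3 !prefers_path_image.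
- move=> w ok; rewrite mem_domain_image; apply: (sat_closed satD) => x y z xyz nlD.
  by rewrite /last3 !prefV; apply: ok; rewrite ?uniqt ?nl.
Qed.

Lemma max_arrow_image t D : max_arrow (domain_image t D) = max_arrow D.
Proof.
have imp u D' : max_arrow D' -> max_arrow (domain_image u D').
  by move=> /max_arrow_saturated satD; apply/max_arrow_saturated/saturated_image.
by apply/idP/idP; [rewrite -{2}(domain_imageK t D) |]; exact: imp.
Qed.

Lemma starts_at_image t w s : starts_at (path_image t w) (t s) = starts_at w s.
Proof. by rewrite !starts_atE index_path_image. Qed.

Lemma ends_at_image t w f : ends_at (path_image t w) (t f) = ends_at w f.
Proof. by rewrite !ends_atE index_path_image. Qed.

Lemma terminal_image t D x : terminal (domain_image t D) (t x) = terminal D x.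
Proof.
apply/terminalP/terminalP => -[w wD wx].
  exists (path_image t^-1 w); first by rewrite -mem_domain_image.
  by rewrite -(ends_at_image t) path_imageVK.
exists (path_image t w); first by rewrite mem_domain_image path_imageK.
by rewrite ends_at_image.
Qed.

Lemma extremal_from_to_image t D s f w :
  extremal_from_to (domain_image t D) (t s) (t f) (path_image t w) =
  extremal_from_to D s f w.
Proof.
rewrite /extremal_from_to (inj_eq perm_inj) !terminal_image mem_domain_image.
by rewrite path_imageK starts_at_image ends_at_image.
Qed.

Lemma extremal_image t D w :
  extremal (domain_image t D) (path_image t w) = extremal D w.
Proof.
apply/extremalP/extremalP => -[s [f]].
  by rewrite -(permKV t s) -(permKV t f) extremal_from_to_image; eauto.
by exists (t s), (t f); rewrite extremal_from_to_image.
Qed.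

Lemma inherited_permP D t :
  reflect (exists s f p q, [/\ extremal_from_to D s f p, extremal_from_to D f s q
                             & path_image t p = q])
          (inherited_perm D t).
Proof.
apply: (iffP existsP) => -[s].
  case/existsP=> f /existsP [p /existsP [q /and3P [sp fq /eqP pq]]].
  by exists s, f, p, q.
case=> f [p [q [sp fq pq]]]; exists s; apply/existsP; exists f.
by apply/existsP; exists p; apply/existsP; exists q; rewrite sp fq pq eqxx.
Qed.

Lemma self_paired_image t D : self_paired D -> self_paired (domain_image t D).
Proof.
case/existsP=> u /andP [/inherited_permP [s [f [p [q [sp fq pq]]]]] /eqP uD].
apply/existsP; exists (t^-1 * (u * t)); apply/andP; split.
  apply/inherited_permP; exists (t s), (t f), (path_image t p), (path_image t q).
  by rewrite !extremal_from_to_image !path_imageM path_imageK pq.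
by rewrite !domain_imageM domain_imageK uD.
Qed.

Lemma isomorphicP D1 D2 :
  reflect (exists t, domain_image t D1 = D2) (isomorphic D1 D2).
Proof. by apply: (iffP existsP) => -[t /eqP e]; exists t. Qed.

Lemma isomorphic_equivalence : equivalence_rel (@isomorphic T).
Proof.
move=> D1 D2 D3; split; first by apply/isomorphicP; exists 1; exact: domain_image1.
case/isomorphicP=> t <-; apply/isomorphicP/isomorphicP => -[u <-].
  by exists (t^-1 * u); rewrite domain_imageM domain_imageK.
by exists (t * u); rewrite domain_imageM.
Qed.

End Action.

(** * Isomorphism classes of maximal domains *)
Section Flip.

Variables (T : finType) (p : lorder T).
Hypothesis T_gt1 : 1 < #|T|.
Implicit Types (D : {set lorder T}) (t : {perm T}).
Local Open Scope group_scope.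

Let X := [set D | max_arrow D && extremal D p].

(** The permutation [tau] carries the extremal path other than [p] to [p]; it is
    the inverse of the permutation that carries [p] to the other path. *)
Lemma extremal_frames D : D \in X ->
  exists tau : {perm T},
    [/\ tau != 1,
        forall t, extremal (domain_image t D) p = (t == 1) || (t == tau)
      & forall t, inherited_perm D t = (t == tau) || (t == tau^-1)].
Proof.
rewrite inE => /andP [maxD /extremalP [s [f sfp]]].
have [q fsq uniq_pq] := extremal_pair T_gt1 maxD sfp.
have [tau tau_q] := path_image_transitive q p.
have tauV_p : path_image tau^-1 p = q by rewrite -tau_q path_imageK.
exists tau; split=> [|t|t].
- apply/eqP => tau1; move: tau_q; rewrite tau1 path_image1 => eqp.
  have /and5P [sf _ _ _ /andP [ps _]] := sfp.
  have /and5P [_ _ _ _ /andP [qf _]] := fsq.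
  by rewrite eqp in qf; rewrite (starts_at_inj ps qf) eqxx in sf.
- rewrite -{1}(path_imageVK t p) extremal_image.
  apply/extremalP/orP => [[s' [f' /uniq_pq [] [_ _ e]]]|[] /eqP->].
  + by left; rewrite -invg_eq1; apply/eqP/(path_image_free (p := p)); rewrite path_image1.
  + right; rewrite -(inj_eq invg_inj); apply/eqP/(path_image_free (p := p)).
    by rewrite tauV_p.
  + by exists s, f; rewrite invg1 path_image1.
  + by exists f, s; rewrite tauV_p.
apply/inherited_permP/orP => [[s' [f' [p' [q' [sp' fq' pq']]]]]|[] /eqP->].
- case: (uniq_pq _ _ _ sp') => -[es' ef' ep']; subst s' f' p'.
    have [[fs _ _]|[_ _ eq']] := uniq_pq _ _ _ fq'.
      by have /and5P [] := sfp; rewrite fs eqxx.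
    by right; apply/eqP/(path_image_free (p := p)); rewrite pq' eq'.
  have [[_ _ eq']|[sf _ _]] := uniq_pq _ _ _ fq'.
    by left; apply/eqP/(path_image_free (p := q)); rewrite pq' eq'.
  by have /and5P [] := sfp; rewrite sf eqxx.
- by exists f, s, q, p.
- by exists s, f, p, q.
Qed.

(** The image of [D] by the permutation [tau] of [extremal_frames], which is the
    only [t] that can be picked when [D] belongs to [X]. *)
Definition flip D : {set lorder T} :=
  domain_image (odflt 1 [pick t : {perm T} |
    (t != 1) && extremal (domain_image t D) p]) D.

Lemma flipP D : D \in X ->
  exists tau : {perm T},
    [/\ tau != 1, flip D = domain_image tau D,
        forall t, extremal (domain_image t D) p = (t == 1) || (t == tau)
      & forall t, inherited_perm D t = (t == tau) || (t == tau^-1)].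
Proof.
case/extremal_frames=> tau [tau1 ext_tau inh_tau]; exists tau; split=> //.
rewrite /flip; case: pickP => [t /andP [t1]|/(_ tau)] /=.
  by rewrite ext_tau (negPf t1) => /eqP->.
by rewrite tau1 ext_tau eqxx orbT.
Qed.

Lemma flip_in : {in X, forall D, flip D \in X}.
Proof.
move=> D DX; have [tau [_ -> ext_tau _]] := flipP DX.
move: DX; rewrite !inE max_arrow_image ext_tau eqxx orbT andbT.
by case/andP.
Qed.

(** The inverse of [tau] is a nontrivial permutation that carries [flip D] to a
    domain with extremal path [p], so it is the one that defines
    [flip (flip D)]. *)
Lemma flipK : {in X, involutive flip}.
Proof.
move=> D DX; have [tau [tau1 eD ext_tau _]] := flipP DX.
have [tau' [_ -> ext_tau' _]] := flipP (flip_in DX).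
have ext_D : extremal D p by move: DX; rewrite inE => /andP [].
have := ext_tau' tau^-1; rewrite eD domain_imageK ext_D invg_eq1 (negPf tau1) /=.
by move=> /esym/eqP <-; exact: domain_imageK.
Qed.

Lemma isomorphic_flip :
  {in X &, forall D1 D2, isomorphic D1 D2 = (D2 == D1) || (D2 == flip D1)}.
Proof.
move=> D1 D2 D1X D2X; have [tau [_ -> ext_tau _]] := flipP D1X.
apply/isomorphicP/orP => [[t eD2]|[] /eqP->]; last 2 first.
- by exists 1; rewrite domain_image1.
- by exists tau.
move: D2X; rewrite inE -eD2 => /andP [_]; rewrite ext_tau.
by case/orP=> /eqP->; [left; rewrite domain_image1 | right].
Qed.

Lemma self_paired_flip : {in X, forall D, self_paired D = (flip D == D)}.
Proof.
move=> D DX; have [tau [_ -> _ inh_tau]] := flipP DX.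
apply/existsP/eqP => [[t]|tauD]; last by exists tau; rewrite inh_tau eqxx tauD eqxx.
rewrite inh_tau => /andP [/orP [] /eqP-> /eqP // eD].
by rewrite -{1}eD -{1}(invgK tau) domain_imageK.
Qed.

Lemma meets_pinned D : max_arrow D -> exists2 D', D' \in X & isomorphic D D'.
Proof.
move=> maxD; have [w ext_w] := max_arrow_extremal T_gt1 maxD.
have [t tw] := path_image_transitive w p.
exists (domain_image t D); last by apply/isomorphicP; exists t.
by rewrite inE max_arrow_image maxD -tw extremal_image.
Qed.

(** The orbits of [flip] are the traces of the isomorphism classes on [X].  On
    the set [Y] of its fixed points the involution is trivial, so that
    self-paired domains of [X] are isomorphic only if they are equal. *)
Lemma class_count : (2 * num_N T = num_P p + num_SP T)%N.
Proof.
have eqvT := @isomorphic_equivalence T.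
have eN : num_N T = #|equivalence_partition (@isomorphic T) X|.
  apply: card_classes_sub => // [|D]; last by rewrite inE; exact: meets_pinned.
  by apply/subsetP => D; rewrite !inE => /andP [].
pose Y := [set D in X | flip D == D].
have eSP : num_SP T = #|equivalence_partition (@isomorphic T) Y|.
  apply: card_classes_sub => // [|D].
    apply/subsetP => D; rewrite inE => /andP [DX flipD].
    by rewrite inE self_paired_flip // flipD andbT; move: DX; rewrite inE => /andP [].
  rewrite inE => /andP [maxD spD]; have [D' D'X DD'] := meets_pinned maxD.
  exists D' => //; rewrite inE D'X -self_paired_flip //.
  by have /isomorphicP [t <-] := DD'; exact: self_paired_image.
have sYX : {subset Y <= X} by move=> D; rewrite inE => /andP [].
have cardY : num_SP T = #|Y|.
  apply/eqP; rewrite -(eqn_pmul2l (ltn0Sn 1)) eSP.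
  rewrite (@card_involution_classes _ _ eqvT Y flip).
  - by rewrite mul2n -addnn eqn_add2l; apply/eqP/eq_card => D; rewrite !inE -andbA andbb.
  - by move=> D DY; have := DY; rewrite inE => /andP [_ /eqP->].
  - by move=> D /sYX; exact: flipK.
  - by move=> D1 D2 /sYX D1X /sYX D2X; exact: isomorphic_flip.
rewrite eN (card_involution_classes eqvT flip_in flipK isomorphic_flip).
by rewrite cardY.
Qed.

End Flip.

(** Self-pairedness is invariant, so the isomorphism classes of self-paired
    domains are full isomorphism classes. *)
Lemma num_SP_le (T : finType) : (num_SP T <= num_N T).
Proof.
apply: subset_leq_card; apply/subsetP => _ /imsetP [D DM ->]; apply/imsetP; exists D.
  by move: DM; rewrite !inE => /andP [].
apply/setP => D'; rewrite !inE; move: DM; rewrite inE => /andP [_ spD].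
case: (boolP (isomorphic D D')) => [/isomorphicP [t <-]|]; rewrite ?andbF // !andbT.
by rewrite self_paired_image ?andbT.
Qed.

Theorem theorem5p9 (A : nat -> finType) (cardA : forall m : nat, #|A m| = m)
    (p : forall m : nat, lorder (A m)) :
  (num_P (p 3) = 1 /\ num_N (A 3) = 1 /\ num_SP (A 3) = 1) /\
  (forall m : nat, 4 <= m ->
    [/\ num_P (p m) = 2 ^ (m - 3) * num_P (p m.-1),
        ((num_N (A m))%:R =
           1 / 2 * ((num_P (p m))%:R + (num_SP (A m))%:R) :> rat)%R
      & (1 / 2 * (num_P (p m))%:R <= ((num_N (A m))%:R : rat) /\
         ((num_N (A m))%:R : rat) <= (num_P (p m))%:R)%R]).
Proof.
have count m : 1 < m -> 2 * num_N (A m) = num_P (p m) + num_SP (A m).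
  by move=> m_gt1; apply: class_count; rewrite cardA.
have P_eq m : 1 < m -> num_P (p m) = 2 ^ 'C(m - 2, 2).
  by move=> m_gt1; rewrite num_P_eq cardA.
split=> [|m m_ge4].
  have := count 3 isT; have := num_SP_le (A 3); rewrite P_eq // bin_small // expn0; lia.
have m_gt1 : 1 < m by apply: leq_trans m_ge4.
have cm := count m m_gt1; have sm := num_SP_le (A m).
split.
- rewrite !P_eq //; last by lia.
  rewrite -expnD; congr (2 ^ _); case: m m_ge4 {m_gt1 cm sm} => [|[|[|m]]] // _.
  by rewrite !subSS !subn0 binS bin1 addnC.
- have : (2 * (num_N (A m))%:R = (num_P (p m))%:R + (num_SP (A m))%:R :> rat)%R.
    by rewrite -natrM cm natrD.
  by move=> h; lra.
- have h : (2 * (num_N (A m))%:R = (num_P (p m))%:R + (num_SP (A m))%:R :> rat)%R.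
    by rewrite -natrM cm natrD.
  have h1 : (0 <= (num_SP (A m))%:R :> rat)%R by exact: ler0n.
  have h2 : ((num_SP (A m))%:R <= (num_N (A m))%:R :> rat)%R by rewrite ler_nat.
  by split; lra.
Qed.
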